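(* In the formal system described in the context (Leśniewski's ontology and mereology extended with Tarski's primitive name ''balls'' and the defined name ''solids''), the following holds: for all names $A, B : N$, if $A \,\varepsilon\, \mathrm{solids}$ and $B \,\varepsilon\, \mathrm{el}\,A$, then $B \,\varepsilon\, \mathrm{solids}$.
   Context: The setting is a higher-order (Coq-style, intuitionistic) theory with a type $N$ of names and a primitive binary predicate $\varepsilon : N \to N \to \mathrm{Prop}$ (written $A \,\varepsilon\, a$). All variables below range over $N$. Axioms and definitions: (Ontology axiom) $\forall A\,a,\ A\,\varepsilon\,a \leftrightarrow \big((\exists B,\ B\,\varepsilon\,A) \wedge (\forall C\,D,\ (C\,\varepsilon\,A \wedge D\,\varepsilon\,A) \to C\,\varepsilon\,D) \wedge (\forall C,\ C\,\varepsilon\,A \to C\,\varepsilon\,a)\big)$. (Singular equality) a predicate $\mathrm{singular\_equality} : N\to N\to\mathrm{Prop}$ with $\mathrm{singular\_equality}\,A\,B \leftrightarrow (A\,\varepsilon\,B \wedge B\,\varepsilon\,A)$. (Name-forming functors) $\mathrm{pt}, \mathrm{el}, \mathrm{Kl}, \mathrm{coll}, \mathrm{subcoll}, \mathrm{distinct} : N \to N$ (''part of'', ''element of'', ''class of'', ''collection of'', ''subcollection of'', ''different from''). (A1) $\forall A\,B,\ A\,\varepsilon\,\mathrm{pt}\,B \to B\,\varepsilon\,\mathrm{distinct}(\mathrm{pt}\,A)$. (A2) the relation $(A,B)\mapsto A\,\varepsilon\,\mathrm{pt}\,B$ is transitive. (MD1) $\forall A\,B,\ A\,\varepsilon\,\mathrm{el}\,B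 \leftrightarrow \big(A\,\varepsilon\,A \wedge (\mathrm{singular\_equality}\,A\,B \vee A\,\varepsilon\,\mathrm{pt}\,B)\big)$. (MD2) $\forall A\,a,\ A\,\varepsilon\,\mathrm{Kl}\,a \leftrightarrow \big(A\,\varepsilon\,A \wedge (\exists B,\ B\,\varepsilon\,a) \wedge (\forall B,\ B\,\varepsilon\,a \to B\,\varepsilon\,\mathrm{el}\,A) \wedge (\forall B,\ B\,\varepsilon\,\mathrm{el}\,A \to \exists C\,D,\ C\,\varepsilon\,a \wedge D\,\varepsilon\,\mathrm{el}\,C \wedge D\,\varepsilon\,\mathrm{el}\,B)\big)$. (A3) $\forall A\,B\,a,\ (A\,\varepsilon\,\mathrm{Kl}\,a \wedge B\,\varepsilon\,\mathrm{Kl}\,a) \to \mathrm{singular\_equality}\,A\,B$. (A4) $\forall A\,a,\ A\,\varepsilon\,a \to \exists B,\ B\,\varepsilon\,\mathrm{Kl}\,a$. (MD3) $\forall P\,a,\ P\,\varepsilon\,\mathrm{coll}\,a \leftrightarrow \big(P\,\varepsilon\,P \wedge \forall Q,\ Q\,\varepsilon\,\mathrm{el}\,P \to \exists C\,D,\ C\,\varepsilon\,a \wedge C\,\varepsilon\,\mathrm{el}\,P \wedge D\,\varepsilon\,\mathrm{el}\,C \wedge D\,\varepsilon\,\mathrm{el}\,Q\big)$. (Subcollection) the functor $\mathrm{subcoll}$ satisfies $\forall A\,B,\ B\,\varepsilon\,\mathrm{el}\,A \leftrightarrow B\,\varepsilon\,\mathrm{subcoll}\,A$. (Mereogeometry)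 $\mathrm{balls} : N$ is a primitive constant name; $\mathrm{solids} : N$ is a constant name satisfying $\forall A,\ A\,\varepsilon\,\mathrm{solids} \leftrightarrow \exists B,\ \big(B\,\varepsilon\,B \wedge B\,\varepsilon\,\mathrm{coll}\,\mathrm{balls} \wedge A\,\varepsilon\,\mathrm{subcoll}\,B\big)$. *)

(* Defs.v *)
From Stdlib Require Import Relation_Definitions.

Record ontology := Ontology {
  name :> Type;
  eps : name -> name -> Prop;
  singular_equality : name -> name -> Prop;
  ontology_axiom : forall A a : name,
    eps A a <->
      (exists B, eps B A)
      /\ (forall C D, eps C A /\ eps D A -> eps C D)
      /\ (forall C, eps C A -> eps C a);
  singular_equalityE : forall A B : name,
    singular_equality A B <-> eps A B /\ eps B A
}.

Arguments eps {o} A a.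
Arguments singular_equality {o} A B.

Notation "A 'ε' a" := (eps A a) (at level 70, no associativity).

(* Functors act on names up to Leibniz equality only: no congruence with
   respect to [singular_equality] is assumed for any of them. [distinct]
   is primitive and occurs only in [pt_asym]. *)
Record mereology := Mereology {
  mereology_ontology :> ontology;
  pt : mereology_ontology -> mereology_ontology;
  el : mereology_ontology -> mereology_ontology;
  Kl : mereology_ontology -> mereology_ontology;
  coll : mereology_ontology -> mereology_ontology;
  subcoll : mereology_ontology -> mereology_ontology;
  distinct : mereology_ontology -> mereology_ontology;
  pt_asym : forall A B : mereology_ontology,
    A ε pt B -> B ε distinct (pt A);
  pt_trans :
    transitive mereology_ontology (fun A B => A ε pt B);
  elE : forall A B : mereology_ontology,
    A ε el B <-> A ε A /\ (singular_equality A B \/ A ε pt B);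
  KlE : forall A a : mereology_ontology,
    A ε Kl a <->
      A ε A
      /\ (exists B, B ε a)
      /\ (forall B, B ε a -> B ε el A)
      /\ (forall B, B ε el A ->
            exists C D, C ε a /\ D ε el C /\ D ε el B);
  Kl_unique : forall A B a : mereology_ontology,
    A ε Kl a /\ B ε Kl a -> singular_equality A B;
  Kl_exists : forall A a : mereology_ontology,
    A ε a -> exists B, B ε Kl a;
  collE : forall P a : mereology_ontology,
    P ε coll a <->
      P ε P
      /\ (forall Q, Q ε el P ->
            exists C D, C ε a /\ C ε el P /\ D ε el C /\ D ε el Q);
  subcollE : forall A B : mereology_ontology,
    B ε el A <-> B ε subcoll A
}.

Arguments pt {m} _.
Arguments el {m} _.
Arguments Kl {m} _.
Arguments coll {m} _.
Arguments subcoll {m} _.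
Arguments distinct {m} _.

Record mereogeometry := Mereogeometry {
  mereogeometry_mereology :> mereology;
  balls : mereogeometry_mereology;
  solids : mereogeometry_mereology;
  solidsE : forall A : mereogeometry_mereology,
    A ε solids <->
      exists B, B ε B /\ B ε coll balls /\ A ε subcoll B
}.

Arguments balls {m}.
Arguments solids {m}.

(* Main.v *)
(* Singular equality is not assumed to be a congruence for [pt], so the argument
   avoids transitivity of [el]. Let A be an element of a collection of balls P,
   and B a part of A. If A is a part of P, so is B. If A is identical with P,
   then A is itself a collection of balls by the ontology axiom, and A replaces
   P as the witness that B is a solid. *)
Require Import Defs.

(** The last clause of [ontology_axiom] at [B ε a] passes everything under [B] on to [a]. This gives
    substitution of identical singulars on the left of [ε], without Leibniz equality. *)
Lemma eps_trans (O : ontology) (A B a : O) : A ε B -> B ε a -> A ε a.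
Proof.
  intros AB Ba.
  apply ontology_axiom in Ba as (_ & _ & sub).
  exact (sub A AB).
Qed.

Theorem mainTheorem2 (M : mereogeometry) (A B : M) :
  A ε solids -> B ε el A -> B ε solids.
Proof.
  intros solA elBA.
  pose proof (proj1 (elE _ _ _) elBA) as [BB [eqBA | ptBA]].
  (* [B] is identical with [A]: the half [B ε A] suffices, with no need to open [solids]. *)
  - apply singular_equalityE in eqBA as [BA _].
    exact (eps_trans _ _ _ _ BA solA).
  - apply solidsE in solA as (P & PP & collP & subAP).
    apply solidsE.
    pose proof (proj1 (elE _ _ _) (proj2 (subcollE _ _ _) subAP))
      as [AA [eqAP | ptAP]].
    + apply singular_equalityE in eqAP as [AP _].
      exists A; repeat split.
      * exact AA.
      * exact (eps_trans _ _ _ _ AP collP).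
      * apply subcollE; exact elBA.
    + exists P; repeat split.
      * exact PP.
      * exact collP.
      * apply subcollE, elE.
        (* Both links are in [pt], so they compose to [B ε pt P], the right disjunct of [elE]. *)
        exact (conj BB (or_intror (pt_trans _ _ _ _ ptBA ptAP))).
Qed.
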